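(* Let $\Gamma$ be the value semigroup of an irreducible curve singularity $(C,O)$. Then the $\Gamma$-subsemimodule graph $G_\Gamma$ is a tree. The set $\mathscr{D}_1$ consists of the single element $\Gamma\setminus\{0\}$, which is designated as the root of $G_\Gamma$.
   Context: $\Gamma\subsetneq\mathbb{N}$ is a numerical semigroup (a submonoid of $\mathbb{N}$ with finite complement), with conductor $c=\min\{n\in\mathbb{N}\mid n+\mathbb{N}\subseteq\Gamma\}$. A $\Gamma$-subsemimodule is a subset $\Delta\subset\Gamma$ with $\Delta+\Gamma\subseteq\Delta$, and $$\mathscr{D}_\ell=\{\Delta\subset\Gamma\mid\Delta\text{ is a }\Gamma\text{-subsemimodule with }\#(\Gamma\setminus\Delta)=\ell\}.$$ For $\Delta\in\mathscr{D}_\ell$ with $\ell\ge1$, let $\gamma_\Delta=\max(\Gamma\setminus\Delta)$ and $m_\ell(\Delta)=\Delta\cup\{\gamma_\Delta\}$; this is an element of $\mathscr{D}_{\ell-1}$. The $\Gamma$-subsemimodule graph $G_\Gamma=(V,E)$ is the directed levelled graph with vertex set $V=\bigsqcup_{\ell=1}^{c}\mathscr{D}_\ell$ and with, for $2\le\ell\le c$, a directed edge from $\Delta\in\mathscr{D}_\ell$ to $\Delta'\in\mathscr{D}_{\ell-1}$ if and only if $m_\ell(\Delta)=\Delta'$. ''Tree'' means that the underlying undirected graph is connected and acyclic. *)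

(* Defs.v *)
From mathcomp Require Import all_boot all_algebra.
From mathcomp Require Import boolp classical_sets cardinality.

Set Implicit Arguments.
Unset Strict Implicit.
Unset Printing Implicit Defensive.

Import GRing.Theory.
Local Open Scope classical_set_scope.
Local Open Scope card_scope.

(* The formal power series ring k[[t]]: the sequence f stands for
   \sum_n f n * t ^ n. *)
Definition fps (k : fieldType) := nat -> k.

Definition fps_const (k : fieldType) (a : k) : fps k :=
  fun n => (if n == 0%N then a else 0)%R.

Definition fps_add (k : fieldType) (f g : fps k) : fps k :=
  fun n => (f n + g n)%R.

Definition fps_mul (k : fieldType) (f g : fps k) : fps k :=
  fun n => (\sum_(i < n.+1) f i * g (n - i)%N)%R.

(* f is nonzero of t-adic order n. *)
Definition has_order (k : fieldType) (f : fps k) (n : nat) : Prop :=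
  f n <> 0%R /\ forall i, (i < n)%N -> f i = 0%R.

Record is_subalgebra (k : fieldType) (R : set (fps k)) : Prop := {
  subalgebra_const : forall a, R (fps_const a);
  subalgebra_add : forall f g, R f -> R g -> R (fps_add f g);
  subalgebra_mul : forall f g, R f -> R g -> R (fps_mul f g)
}.

(* The completed local ring R of an irreducible curve germ (C, O) with residue
   field k is embedded in its normalization k[[t]] by a parametrization of C.
   The subrings arising in this way are the k-subalgebras containing some
   t ^ n k[[t]] (nonzero conductor, i.e. k[[t]] is the normalization of R and is
   finite over it); O is a singular point iff R is not integrally closed,
   i.e. iff R differs from k[[t]]. *)
Record irreducible_curve_singularity (k : fieldType) (R : set (fps k)) : Prop := {
  curve_subalgebra : is_subalgebra R;
  curve_conductor : exists n : nat,
    forall f : fps k, (forall i, (i < n)%N -> f i = 0%R) -> R f;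
  curve_singular : R <> setT
}.

Definition value_semigroup (k : fieldType) (R : set (fps k)) : set nat :=
  [set n | exists2 f, R f & has_order f n].

(* The minimum and maximum of a set of naturals, with junk value 0 when they do
   not exist. *)
Definition min_set (A : set nat) : nat :=
  xget 0%N [set n | A n /\ forall m, A m -> (n <= m)%N].

Definition max_set (A : set nat) : nat :=
  xget 0%N [set n | A n /\ forall m, A m -> (m <= n)%N].

Definition conductor (Gamma : set nat) : nat :=
  min_set [set n | forall m, Gamma (n + m)%N].

Definition is_subsemimodule (Gamma Delta : set nat) : Prop :=
  Delta `<=` Gamma /\ forall d g, Delta d -> Gamma g -> Delta (d + g)%N.

Definition subsemimodules (Gamma : set nat) (l : nat) : set (set nat) :=
  [set Delta | is_subsemimodule Gamma Delta /\ Gamma `\` Delta #= `I_l].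

Definition add_max_gap (Gamma Delta : set nat) : set nat :=
  Delta `|` [set max_set (Gamma `\` Delta)].

Record digraph (T : Type) := Digraph {
  vertex : set T;
  edge : T -> T -> Prop
}.

(* Adjacency in the underlying undirected graph. *)
Definition adjacent (T : Type) (G : digraph T) (u v : T) : bool :=
  `[< [/\ vertex G u, vertex G v & edge G u v \/ edge G v u] >].

Definition is_connected (T : eqType) (G : digraph T) : Prop :=
  vertex G !=set0 /\
  forall u v, vertex G u -> vertex G v ->
    exists2 p : seq T, path (adjacent G) u p & last u p = v.

(* Two adjacent vertices u, v always give a closed sequence [:: u; v], which
   traverses one edge back and forth and is not a cycle of the graph; a loop
   would give one of size 1. *)
Definition is_acyclic (T : eqType) (G : digraph T) : Prop :=
  forall p : seq T, ucycle (adjacent G) p -> size p = 0%N \/ size p = 2%N.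

Definition is_tree (T : eqType) (G : digraph T) : Prop :=
  is_connected G /\ is_acyclic G.

Definition is_rooted_tree (T : eqType) (G : digraph T) (r : T) : Prop :=
  is_tree G /\ vertex G r.

(* The disjoint union of the D_l is encoded by pairs (l, Delta). *)
Definition subsemimodule_graph (Gamma : set nat) : digraph (nat * set nat)%type :=
  let c := conductor Gamma in
  {| vertex := [set v | (1 <= v.1 <= c)%N /\ subsemimodules Gamma v.1 v.2];
     edge := fun u v =>
       [/\ (2 <= u.1 <= c)%N, subsemimodules Gamma u.1 u.2,
           v.1 = u.1.-1, subsemimodules Gamma v.1 v.2 &
           add_max_gap Gamma u.2 = v.2] |}.

(* Main.v *)
Require Import Defs.
From mathcomp Require Import all_boot all_algebra.
From mathcomp Require Import boolp classical_sets cardinality.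

Set Implicit Arguments.
Unset Strict Implicit.
Unset Printing Implicit Defensive.

Import GRing.Theory.
Local Open Scope classical_set_scope.

(** An edge of G_Gamma lowers the level by one, and its target is determined by
    its source. In a cycle the two neighbours of a vertex of maximal level
    would both be the target of its unique outgoing edge, hence equal, so the
    graph has no cycle. It is connected because every vertex of level at least
    2 does have an outgoing edge, which leads down to the only vertex
    Gamma \ {0} of level 1. *)

(** * Levelled digraphs: acyclicity and connectedness *)

Lemma adjacent_sym (T : eqType) (G : digraph T) : symmetric (adjacent G).
Proof.
by move=> u v; apply/asboolP/asboolP => -[hu hv e]; split=> //; case: e; auto.
Qed.

Lemma levelled_acyclic (T : eqType) (G : digraph T) (level : T -> nat) :
    (forall u v, edge G u v -> level u = (level v).+1) ->
    (forall u v w, edge G u v -> edge G u w -> v = w) ->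
  is_acyclic G.
Proof.
move=> edgeS edge_inj p pcyc; case: (posnP (size p)) => [->|p_gt0]; [by left|].
have [x xp xmax] : exists2 x, x \in p & forall y, y \in p -> level y <= level x.
  elim: p p_gt0 {pcyc} => // a [|b q] IHq _.
    by exists a; rewrite ?mem_head // => y; rewrite inE => /eqP->.
  have [//|x xq xmax] := IHq; have [xa|ax] := leqP (level x) (level a).
    exists a; rewrite ?mem_head // => y; rewrite in_cons => /predU1P[->//|yq].
    exact: leq_trans (xmax y yq) xa.
  exists x; first by rewrite in_cons xq orbT.
  by move=> y; rewrite in_cons => /predU1P[->|/xmax//]; exact: ltnW.
(* An edge from [y] to [x] would put [y] one level above the maximum. *)
have out y : y \in p -> adjacent G x y -> edge G x y.
  move=> /xmax yx /asboolP[_ _ [//|/edgeS yxS]].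
  by rewrite yxS ltnn in yx.
have [i q pq] := rot_to xp.
have mem_q y : y \in x :: q -> y \in p by rewrite -pq mem_rot.
move: pcyc; rewrite -(rot_ucycle i) -(size_rot i) pq => /andP[].
(* A cycle of length one would be a loop, forcing [level x] to equal its own successor; length two
   is allowed. From length three on, [y] and [z] are the two cyclic neighbours of [x]. *)
case: q {pq} mem_q => [|y q] mem_q.
  by rewrite /= andbT => /(out _ xp)/edgeS /n_Sn.
case/lastP: q mem_q => [|q z] mem_q; first by right.
rewrite /= rcons_path last_rcons => /and3P[xy _ zx] /and3P[_ yq _].
have mem_z : z \in [:: x, y & rcons q z].
  by rewrite !in_cons mem_rcons mem_head !orbT.
have mem_y : y \in [:: x, y & rcons q z] by rewrite !in_cons eqxx orbT.
have yz : y = z.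
  apply: (edge_inj x); first exact: out (mem_q _ mem_y) xy.
  by apply: out (mem_q _ mem_z) _; rewrite adjacent_sym.
by rewrite yz mem_rcons mem_head in yq.
Qed.

Lemma levelled_connected (T : eqType) (G : digraph T) (level : T -> nat) (r : T) :
    vertex G r ->
    (forall u, vertex G u -> u <> r ->
       exists v, [/\ vertex G v, edge G u v & level u = (level v).+1]) ->
  is_connected G.
Proof.
move=> hr step.
have to_root u : vertex G u -> exists2 p, path (adjacent G) u p & last u p = r.
  have [n] := ubnP (level u); elim: n u => // n IHn u lt_un hu.
  have [->|ur] := pselect (u = r); first by exists [::].
  have [v [hv uv luv]] := step u hu ur.
  have [||p vp pr] := IHn v; [by rewrite luv in lt_un | by [] |].
  by exists (v :: p); rewrite //= vp andbT; apply/asboolP; split=> //; left.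
split; first by exists r.
move=> u v /to_root[p up pr] /to_root[q vq qr].
(* Follow [p] from [u] to the root, then [q] backwards from the root to [v]. *)
exists (p ++ rev (belast v q)).
  by rewrite cat_path up /= pr -qr rev_path; under eq_path do rewrite adjacent_sym.
case: q vq qr => [|a q] _ /= qr; first by rewrite cats0 pr.
by rewrite rev_cons last_cat last_rcons.
Qed.

(** * Finite cardinals and extrema of sets of naturals *)

Lemma card_II_inj (T : Type) (A : set T) m n :
  (A #= `I_m)%card -> (A #= `I_n)%card -> m = n.
Proof.
move=> Am An; apply/card_eq_II; apply: card_eq_trans An.
by rewrite card_eq_sym.
Qed.

Lemma card_II_setD1 (T : Type) (A : set T) (x : T) n :
  A x -> (A #= `I_n.+1)%card -> (A `\ x #= `I_n)%card.
Proof.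
move=> Ax An.
have /finite_setP[m Am] : finite_set (A `\ x).
  by apply/finite_setD/finite_setP; exists n.+1.
have AmS : (A #= `I_m.+1)%card by apply/eq_cardSP; exists x.
by have [<-] := card_II_inj AmS An.
Qed.

(** The cardinal [n.+1] makes [A] finite and nonempty, so the junk value is avoided. By induction,
    the maximum is the larger of one removed element and the maximum of the rest. *)
Lemma max_setP (A : set nat) n : (A #= `I_n.+1)%card ->
  A (max_set A) /\ forall m, A m -> m <= max_set A.
Proof.
move=> An.
apply: (@xgetPex _ 0 [set n | A n /\ forall m, A m -> m <= n]).
elim: n A An => [|n IHn] A /eq_cardSP[x Ax Axn].
  exists x; split=> // m Am; have [->//|mx] := pselect (m = x).
  have : (A `\ x) m by [].
  by move: Axn; rewrite II0 card_eq0 => /eqP->.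
have [y [[Ay _] ymax]] := IHn _ Axn.
exists (maxn x y); split; first by rewrite /maxn; case: ifP.
move=> m Am; have [->|mx] := pselect (m = x); first exact: leq_maxl.
by rewrite leq_max ymax ?orbT.
Qed.

Lemma min_setP (A : set nat) : A !=set0 ->
  A (min_set A) /\ forall m, A m -> min_set A <= m.
Proof.
case=> x Ax.
apply: (@xgetPex _ 0 [set n | A n /\ forall m, A m -> n <= m]).
have exA : exists n, `[< A n >] by exists x; apply/asboolP.
case: (ex_minnP exA) => n /asboolP An nmin.
by exists n; split=> // m /asboolP; exact: nmin.
Qed.

(** * Subsemimodules and their graph *)

(** Needed for level 1 to lie in the range of levels, so that the root is a vertex. *)
Lemma conductor_gt0 (Gamma : set nat) :
    (exists n, forall m, Gamma (n + m)) -> Gamma <> setT ->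
  0 < conductor Gamma.
Proof.
move=> /min_setP[+ _] GT; rewrite -/(conductor Gamma) lt0n => hc.
apply/negP => /eqP c0; apply: GT; apply/seteqP; split=> // m _.
by have := hc m; rewrite c0.
Qed.

(** Translating the largest gap by a positive element of [Gamma] gives an element of [Gamma] beyond
    every gap, hence one of [Delta]. *)
Lemma add_max_gap_subsemimodules (Gamma Delta : set nat) l :
    (forall m n, Gamma m -> Gamma n -> Gamma (m + n)) ->
    subsemimodules Gamma l.+1 Delta ->
  subsemimodules Gamma l (add_max_gap Gamma Delta).
Proof.
move=> GD [[DG Dmod] Dl].
have [[Gmax nDmax] maxP] := max_setP Dl.
split; last by rewrite /add_max_gap -setDDl; exact: card_II_setD1.
split=> [n [/DG//|->//]|d g [Dd|->] Gg]; first by left; exact: Dmod.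
have [->|g_gt0] := posnP g; first by right; rewrite addn0.
left; apply: contrapT => nD.
have := maxP _ (conj (GD _ _ Gmax Gg) nD).
by rewrite -{2}[max_set _]addn0 leq_add2l leqNgt g_gt0.
Qed.

(** If [Delta] contained 0 it would contain all of [Gamma] and leave no gap; so 0 is the single
    gap. *)
Lemma subsemimodules1 (Gamma : set nat) : Gamma 0 ->
    (forall m n, Gamma m -> Gamma n -> Gamma (m + n)) ->
  subsemimodules Gamma 1 = [set Gamma `\ 0].
Proof.
move=> G0 GD; apply/seteqP; split=> Delta.
  move=> [[DG Dmod] D1].
  have nD0 : ~ Delta 0.
    move=> D0; have /eq_cardSP[x [Gx nDx] _] := D1.
    by apply: nDx; rewrite -[x]add0n; exact: Dmod.
  apply/seteqP; split=> n.
    by move=> Dn; split; [exact: DG | move=> n0; rewrite /= n0 in Dn].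
  move=> [Gn n0]; apply: contrapT => nDn.
  have := card_II_setD1 (conj G0 nD0) D1.
  rewrite II0 card_eq0 => /eqP GD0.
  by have : (set0 : set nat) n by rewrite -GD0.
move=> ->; split; last first.
  rewrite setDD (_ : _ `&` _ = [set 0%N]) ?card_set1//.
  by apply/seteqP; split=> n; [case|move=> ->].
split=> [n []//|d g [Gd d0] Gg]; split; first exact: GD.
by move=> /eqP; rewrite addn_eq0 => /andP[/eqP].
Qed.

Lemma subsemimodule_graph_rooted_tree (Gamma : set nat) : Gamma 0 ->
    (forall m n, Gamma m -> Gamma n -> Gamma (m + n)) ->
    0 < conductor Gamma ->
  is_rooted_tree (subsemimodule_graph Gamma) (1, Gamma `\ 0).
Proof.
move=> G0 GD c_gt0.
have hr : vertex (subsemimodule_graph Gamma) (1, Gamma `\ 0).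
  by split=> //=; rewrite subsemimodules1.
split=> //; split.
  apply: (levelled_connected (level := fst) hr) => -[[|[|l]] Delta] [/= lc hD].
  - by [].
  - by move: hD; rewrite subsemimodules1// => ->.
  - move=> _; exists (l.+1, add_max_gap Gamma Delta).
    have hD' := add_max_gap_subsemimodules GD hD.
    by split=> //; split=> //=; exact: ltnW.
apply: (levelled_acyclic (level := fst)) => [u v [/andP[u2 _] _ -> _ _]|].
  by rewrite prednK // ltnW.
by move=> u [v1 v2] [w1 w2] [/= _ _ -> _ <-] [/= _ _ -> _ <-].
Qed.

(** * Orders of power series and the value semigroup *)

Lemma fps_mul_const (k : fieldType) (a : k) (f : fps k) n :
  fps_mul (fps_const a) f n = (a * f n)%R.
Proof.
rewrite /fps_mul big_ord_recl subn0 big1 ?addr0// => i _.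
by rewrite /fps_const /= mul0r.
Qed.

Lemma has_order_mul (k : fieldType) (f g : fps k) m n :
  has_order f m -> has_order g n -> has_order (fps_mul f g) (m + n).
Proof.
move=> [fm f0] [gn g0]; split=> [|i lt_i]; rewrite /fps_mul.
  have lt_m : m < (m + n).+1 by rewrite ltnS leq_addr.
  (* Only the index [m] contributes: before it [f] vanishes, after it [g] does. The product of the
     two leading coefficients is nonzero in a field. *)
  rewrite (bigD1 (Ordinal lt_m))//= big1 => [|j jm].
    by rewrite addr0 addKn; apply/eqP; rewrite mulf_neq0//; exact/eqP.
  have [lt_jm|] := ltnP j m; first by rewrite f0 ?mul0r.
  rewrite leq_eqVlt => /predU1P[mj|lt_mj].
    by rewrite -val_eqE /= -mj eqxx in jm.
  by rewrite [g _]g0 ?mulr0// ltn_subLR ?ltn_add2r// -ltnS.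
rewrite big1// => j _; have [lt_jm|le_mj] := ltnP j m.
  by rewrite f0 ?mul0r.
rewrite [g _]g0 ?mulr0// ltn_subLR -1?ltnS//.
by apply: leq_trans lt_i _; rewrite leq_add2r.
Qed.

Lemma value_semigroup0 (k : fieldType) (R : set (fps k)) :
  irreducible_curve_singularity R -> value_semigroup R 0.
Proof.
move=> hR.
exists (fps_const 1%R); first exact: subalgebra_const (curve_subalgebra hR) _.
by split=> //; apply/eqP; rewrite /fps_const eqxx oner_neq0.
Qed.

Lemma value_semigroupD (k : fieldType) (R : set (fps k)) :
    irreducible_curve_singularity R -> forall m n,
  value_semigroup R m -> value_semigroup R n -> value_semigroup R (m + n).
Proof.
move=> hR m n [f Rf fm] [g Rg gn]; exists (fps_mul f g); last exact: has_order_mul.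
exact: subalgebra_mul (curve_subalgebra hR) _ _ Rf Rg.
Qed.

Lemma value_semigroup_cofinite (k : fieldType) (R : set (fps k)) :
    irreducible_curve_singularity R ->
  exists n, forall m, value_semigroup R (n + m).
Proof.
move=> hR.
have [n Rn] := curve_conductor hR; exists n => m.
(* The monomial of degree [n + m]. *)
exists (fun i => (i == n + m)%:R%R); last first.
  split=> [|i /ltn_eqF->//]; by apply/eqP; rewrite eqxx oner_neq0.
by apply: Rn => i lt_in; rewrite ltn_eqF// ltn_addr.
Qed.

(* If every order occurs in R, the lowest term of a series can be cancelled by
   an element of R until the conductor is reached. *)
Lemma value_semigroup_neqT (k : fieldType) (R : set (fps k)) :
  irreducible_curve_singularity R -> value_semigroup R <> setT.
Proof.
move=> hR GT; apply: (curve_singular hR); apply/seteqP; split=> // f _.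
have [N RN] := curve_conductor hR.
have [_ RD RM] := curve_subalgebra hR.
(* Induction lowers the required order from [N] to 0; at [m = N] the vanishing condition is
   empty. *)
suff tail m (g : fps k) : (forall i, i < N - m -> g i = 0%R) -> R g.
  by apply: (tail N) => i; rewrite subnn.
elim: m g => [|m IHm] g g0; first by apply: RN => i lt_iN; rewrite g0 ?subn0.
have [h Rh [hj h0]] : value_semigroup R (N - m.+1) by rewrite GT.
(* The scalar [a] is chosen so that [g - a h] also vanishes at [j]. *)
set j := N - m.+1 in hj h0 g0; set a := (g j / h j)%R.
have -> : g = fps_add (fun n => g n - a * h n)%R (fps_mul (fps_const a) h).
  by apply/funext => n; rewrite /fps_add fps_mul_const subrK.
apply: RD; last by apply: RM => //; exact: subalgebra_const (curve_subalgebra hR) _.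
apply: IHm => i lt_i; have [lt_ij|] := ltnP i j.
  by rewrite g0// h0// mulr0 subrr.
rewrite leq_eqVlt => /predU1P[<-|lt_ji].
  by rewrite /a divfK ?subrr//; exact/eqP.
(* An inequality only: by truncated subtraction [j] is 0 when [N - m] is 0. *)
have lt_jNm : N - m <= j.+1 by rewrite /j subnS; case: (N - m).
by have := leq_trans lt_i lt_jNm; rewrite ltnS leqNgt lt_ji.
Qed.

Theorem theorem3p1 (k : fieldType) (R : set (fps k))
    (hR : irreducible_curve_singularity R)
    (Gamma : set nat) (hGamma : Gamma = value_semigroup R) :
  is_rooted_tree (subsemimodule_graph Gamma) (1%N, Gamma `\ 0%N) /\
  subsemimodules Gamma 1 = [set Gamma `\ 0%N].
Proof.
have G0 := value_semigroup0 hR; have GD := value_semigroupD hR.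
have c_gt0 := conductor_gt0 (value_semigroup_cofinite hR)
  (value_semigroup_neqT hR).
rewrite hGamma; split; last exact: subsemimodules1.
exact: subsemimodule_graph_rooted_tree.
Qed.
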